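(* Let $d\ge 1$, let $\Omega$ be an open bounded connected polygonal subset of $\mathbb{R}^d$, let $\Lambda:\Omega\to M_d(\mathbb{R})$ be a bounded measurable function for which there exists $\alpha_0>0$ with $\Lambda(x)\xi\cdot\xi\ge\alpha_0|\xi|^2$ for a.e. $x\in\Omega$ and all $\xi\in\mathbb{R}^d$, and let $f\in L^2(\Omega)$. Let $\mathcal{D}=(\mathcal{M},\mathcal{E},\mathcal{P})$ be an admissible discretization of $\Omega$ and let $\nu=(\nu_K)_{K\in\mathcal{M}}$ be a family of positive real numbers. Then there exists one and only one solution $(u,\mathbf{v},F)$ of the mixed finite volume scheme on $\mathcal{D}$ with penalization family $\nu$.
   Context: **Admissible discretization.** An admissible discretization of $\Omega$ is $\mathcal{D}=(\mathcal{M},\mathcal{E},\mathcal{P})$ where: (i) $\mathcal{M}$ is a finite family of non-empty open polygonal convex disjoint subsets of $\Omega$ (control volumes) with $\overline{\Omega}=\bigcup_{K\in\mathcal{M}}\overline{K}$. (ii) $\mathcal{E}$ is a finite family of disjoint subsets of $\overline{\Omega}$ (edges) such that for every $\sigma\in\mathcal{E}$ there exist an affine hyperplane $E$ of $\mathbb{R}^d$ and $K\in\mathcal{M}$ with $\sigma\subset\partial K\cap E$ and $\sigma$ a non-empty open convex subset of $E$. For every $K\in\mathcal{M}$ there is a subset $\mathcal{E}_K$ of $\mathcal{E}$ with $\partial K=\bigcup_{\sigma\in\mathcal{E}_K}\overline{\sigma}$. For every $\sigma\in\mathcal{E}$, either $\sigma\subset\partial\Omega$ or $\overline{\sigma}=\overline{K}\cap\overline{L}$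 for some $(K,L)\in\mathcal{M}\times\mathcal{M}$; in the latter case one writes $\sigma=K|L$. (iii) $\mathcal{P}=(\mathbf{x}_K)_{K\in\mathcal{M}}$ is a family of points with $\mathbf{x}_K\in K$ for all $K\in\mathcal{M}$. **Notation.** $\mathrm{m}(K)$ is the $d$-dimensional measure of $K$; $\mathbf{x}_\sigma$ is the barycenter of $\sigma$; $\mathcal{E}_{\rm int}$ (resp. $\mathcal{E}_{\rm ext}$) is the set of edges $\sigma\not\subset\partial\Omega$ (resp. $\sigma\subset\partial\Omega$); $\mathcal{N}_K$ is the set of neighbouring control volumes of $K$, i.e. those $L\in\mathcal{M}$ such that $\overline{K}\cap\overline{L}$ is the closure of an edge $\sigma=K|L$ of the discretization. $H_{\mathcal{D}}$ is the set of real functions on $\Omega$ constant on each $K\in\mathcal{M}$ (value $h_K$ on $K$ for $h\in H_{\mathcal D}$); $\mathcal{F}_{\mathcal{D}}$ is the set of families of real numbers $F=(F_{K,\sigma})_{K\in\mathcal{M},\sigma\in\mathcal{E}_K}$. **Space $L_\nu(\mathcal{D})$.** For a family $\nu=(\nu_K)_{K\in\mathcal{M}}$ of nonnegative numbers, $L_\nu(\mathcal{D})$ is the space of $(u,\mathbf{v},F)\in H_{\mathcal{D}}\times H_{\mathcal{D}}^d\times\mathcal{F}_{\mathcal{D}}$ such that $$\mathbf{v}_K\cdot(\mathbf{x}_\sigma-\mathbf{x}_K)+\mathbf{v}_L\cdot(\mathbf{x}_L-\mathbf{x}_\sigma)+\nu_K\mathrm{m}(K)F_{K,\sigma}-\nu_L\mathrm{m}(L)F_{L,\sigma}=u_L-u_K$$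 for all $K\in\mathcal{M}$ and $L\in\mathcal{N}_K$, with $\sigma=K|L$, and $$\mathbf{v}_K\cdot(\mathbf{x}_\sigma-\mathbf{x}_K)+\nu_K\mathrm{m}(K)F_{K,\sigma}=-u_K\quad\text{for all }K\in\mathcal{M},\ \sigma\in\mathcal{E}_K\cap\mathcal{E}_{\rm ext}.$$ **Mixed finite volume scheme.** A solution of the scheme on $\mathcal{D}$ with penalization family $\nu$ is $(u,\mathbf{v},F)\in L_\nu(\mathcal{D})$ such that $F_{K,\sigma}+F_{L,\sigma}=0$ for all $\sigma=K|L\in\mathcal{E}_{\rm int}$; $\mathrm{m}(K)\Lambda_K\mathbf{v}_K=\sum_{\sigma\in\mathcal{E}_K}F_{K,\sigma}(\mathbf{x}_\sigma-\mathbf{x}_K)$ for all $K\in\mathcal{M}$, where $\Lambda_K=\frac{1}{\mathrm{m}(K)}\int_K\Lambda(x)\,dx$; $-\sum_{\sigma\in\mathcal{E}_K}F_{K,\sigma}=\int_K f(x)\,dx$ for all $K\in\mathcal{M}$. *)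

(* Defs.v *)
From HB Require Import structures.
From mathcomp Require Import all_boot all_order all_algebra.
From mathcomp Require Import all_classical all_reals all_analysis.
Import Order.TTheory GRing.Theory Num.Theory.
Import numFieldNormedType.Exports.

Set Implicit Arguments.
Unset Strict Implicit.
Unset Printing Implicit Defensive.

Local Open Scope classical_set_scope.
Local Open Scope ring_scope.

(* Points of R^n are row vectors 'rV[R]_n; the library topology on them is     *)
(* the usual one, but the library norm is the sup norm, so that Euclidean      *)
(* quantities are written with the dot product below.                          *)
Definition dotv (R : realType) (n : nat) (x y : 'rV[R]_n) : R :=
  \sum_(i < n) x ord0 i * y ord0 i.

(* A x, for x seen as a column. *)
Definition mxapp (R : realType) (n : nat) (A : 'M[R]_n) (x : 'rV[R]_n) :
  'rV[R]_n := x *m A^T.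

Definition boundary (T : topologicalType) (A : set T) : set T :=
  closure A `\` A°.

Definition box (R : realType) (n : nat) (I : 'rV[R]_n * 'rV[R]_n) :
  set 'rV[R]_n := [set x | forall i, I.1 ord0 i <= x ord0 i < I.2 ord0 i].

Definition box_volume (R : realType) (n : nat) (I : 'rV[R]_n * 'rV[R]_n) : R :=
  \prod_(i < n) Num.max 0 (I.2 ord0 i - I.1 ord0 i).

(* The coverings are indexed by countable, possibly finite or empty, sets of   *)
(* boxes: for n = 0 the only box has volume 1, and the measure obtained is the *)
(* Dirac mass on R^0.                                                          *)
Definition lebesgue_outer (R : realType) (n : nat) (A : set 'rV[R]_n) :
    \bar R :=
  ereal_inf [set (\esum_(I in S) (box_volume I)%:E)%E | S in
    [set S : set ('rV[R]_n * 'rV[R]_n) |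
       countable S /\ A `<=` \bigcup_(I in S) box I]].

Section lebesgue_outer_theory.
Context (R : realType) (n : nat).
Local Open Scope ereal_scope.
Implicit Types A B : set 'rV[R]_n.

Lemma box_volume_ge0 (I : 'rV[R]_n * 'rV[R]_n) : 0 <= (box_volume I)%:E.
Proof.
rewrite lee_fin; apply: prodr_ge0 => i _.
by rewrite le_max lexx.
Qed.

Lemma lebesgue_outer_ge0 A : 0 <= lebesgue_outer A.
Proof.
apply: le_ereal_inf_tmp => _ [S _ <-].
by apply: esum_ge0 => I _; exact: box_volume_ge0.
Qed.

Lemma lebesgue_outer0 : lebesgue_outer (@set0 'rV[R]_n) = 0.
Proof.
apply/eqP; rewrite eq_le lebesgue_outer_ge0 andbT.
apply: ereal_inf_lbound; exists set0; last by rewrite esum_set0.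
by split => //; exact: countable0.
Qed.

Lemma le_lebesgue_outer :
  {homo @lebesgue_outer R n : A B / A `<=` B >-> A <= B}.
Proof.
move=> A B AB; apply: le_ereal_inf_tmp => _ [S [cS BS] <-].
apply: ereal_inf_lbound; exists S => //; split => //.
exact: subset_trans BS.
Qed.

Lemma lebesgue_outer_sigma_subadditive :
  sigma_subadditive (@lebesgue_outer R n).
Proof.
move=> A; have [[i ioo]|] := pselect (exists i, lebesgue_outer (A i) = +oo).
  rewrite (eseries_pinfty _ _ ioo) ?leey// => k _.
  by rewrite -ltNye (lt_le_trans _ (lebesgue_outer_ge0 _)).
rewrite -forallNE => Aoo.
apply/lee_addgt0Pr => e e0.
rewrite (le_trans _ (epsilon_trick _ _ (ltW e0)))//; last first.
  by move=> k; exact: lebesgue_outer_ge0.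
pose P k (S : set ('rV[R]_n * 'rV[R]_n)) :=
  (countable S /\ A k `<=` \bigcup_(I in S) box I) /\
  \esum_(I in S) (box_volume I)%:E
    <= lebesgue_outer (A k) + (e / (2 ^ k.+1)%:R)%:E.
have [G PG] : {G : (set ('rV[R]_n * 'rV[R]_n))^nat & forall k, P k (G k)}.
  apply: (@choice _ _ P) => k; rewrite /P.
  have fA : lebesgue_outer (A k) \is a fin_num.
    by rewrite ge0_fin_numE ?lebesgue_outer_ge0// ltey; exact/eqP/Aoo.
  have ek : (0 < e / (2 ^ k.+1)%:R)%R by rewrite divr_gt0.
  have [_ [S SA <-] /ltW SAk] := lb_ereal_inf_adherent ek fA.
  by exists S.
apply: (@le_trans _ _ (\esum_(I in \bigcup_k G k) (box_volume I)%:E)).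
  apply: ereal_inf_lbound; exists (\bigcup_k G k) => //; split.
    by apply: bigcup_countable => // k _; case: (PG k) => -[].
  move=> x [k _ /(PG k).1.2 [I GI Ix]].
  by exists I => //; exists k.
rewrite seqDU_bigcup_eq esum_bigcupT; last 2 first.
- exact: trivIset_seqDU.
- exact: box_volume_ge0.
rewrite -nneseries_esumT; last first.
  by move=> k; apply: esum_ge0 => I _; exact: box_volume_ge0.
apply: lee_nneseries => [k _ _|k _].
  by apply: esum_ge0 => I _; exact: box_volume_ge0.
apply: le_trans (PG k).2.
rewrite [leLHS]esum_mkcond [leRHS]esum_mkcond; apply: le_esum => I _.
have [/set_mem GI|_] := boolP (I \in seqDU G k).
  by rewrite (mem_set (subset_seqDU GI)).
by case: ifP => // _; exact: box_volume_ge0.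
Qed.

HB.instance Definition _ := isOuterMeasure.Build R 'rV[R]_n
  (@lebesgue_outer R n) lebesgue_outer0 lebesgue_outer_ge0 le_lebesgue_outer
  lebesgue_outer_sigma_subadditive.

End lebesgue_outer_theory.

Definition lebesgue_outer_measure (R : realType) (n : nat) :
  {outer_measure set 'rV[R]_n -> \bar R} := @lebesgue_outer R n.

(* R^n with the sigma-algebra of Lebesgue measurable sets. *)
Notation lebesgue_space R n := (caratheodory_type (lebesgue_outer_measure R n)).

Definition lebesgue (R : realType) (n : nat) :
  {measure set (lebesgue_space R n) -> \bar R} := lebesgue_outer_measure R n.

Definition volume (R : realType) (n : nat) (A : set 'rV[R]_n) : R :=
  fine (lebesgue R n A).

Definition hyperplane (R : realType) (n : nat) (E : set 'rV[R]_n) : Prop :=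
  exists (w : 'rV[R]_n) (c : R), w != 0 /\ E = [set x | dotv x w = c].

(* For a bounded convex open set this says that the set is the interior of a   *)
(* convex polytope; for n = 1 it says that the boundary is finite.             *)
Definition polygonal (R : realType) (n : nat) (A : set 'rV[R]_n) : Prop :=
  exists2 H : set (set 'rV[R]_n), finite_set H /\ H `<=` @hyperplane R n &
    boundary A `<=` \bigcup_(E in H) E.

Definition relatively_open (T : topologicalType) (E A : set T) : Prop :=
  exists2 U : set T, open U & A = E `&` U.

Definition centroid (R : realType) (n : nat) (A : set 'rV[R]_n) : 'rV[R]_n :=
  \row_i ((volume A)^-1 * \int[lebesgue R n]_(s in A) (s : 'rV[R]_n) ord0 i).

Definition chart (R : realType) (d : nat)
    (p : 'rV[R]_d * 'M[R]_(d.-1, d)) (s : 'rV[R]_(d.-1)) : 'rV[R]_d :=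
  p.1 + s *m p.2.

(* Isometric charts of the hyperplanes that contain sigma: the rows of the     *)
(* linear part are orthonormal.                                                *)
Definition isometric_charts (R : realType) (d : nat) (sigma : set 'rV[R]_d) :
    set ('rV[R]_d * 'M[R]_(d.-1, d)) :=
  [set p | p.2 *m p.2^T = 1%:M /\ sigma `<=` range (chart p)].

(* The barycenter of a subset of a hyperplane for the (d-1)-dimensional        *)
(* measure, which is the image of the Lebesgue measure of R^(d-1) under an     *)
(* isometric chart; the result does not depend on the chart that get selects.  *)
Definition barycenter (R : realType) (d : nat) (sigma : set 'rV[R]_d) :
    'rV[R]_d :=
  let p := get (isometric_charts sigma) in
  chart p (centroid (chart p @^-1` sigma)).

Record discretization (R : realType) (d : nat) := Discretization {
  cell : finType;
  edge : finType;
  cell_set : cell -> set 'rV[R]_d;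
  edge_set : edge -> set 'rV[R]_d;
  edges_of : cell -> {set edge};
  center : cell -> 'rV[R]_d }.

Section discretization_notions.
Context (R : realType) (d : nat) (Omega : set 'rV[R]_d).
Variable D : discretization R d.
Implicit Types (K L : cell D) (s : edge D).

(* s = K|L. In an admissible discretization this forces K <> L (a hyperplane   *)
(* has empty interior) and puts s in both edges_of K and edges_of L.           *)
Definition interface s K L : Prop :=
  closure (edge_set s) = closure (cell_set K) `&` closure (cell_set L).

Definition neighbours K : set (cell D) :=
  [set L | exists s, interface s K L].

Definition exterior s : Prop := edge_set s `<=` boundary Omega.

Record admissible : Prop := Admissible {
  cell_nonempty : forall K, cell_set K !=set0;
  cell_open : forall K, open (cell_set K);
  cell_polygonal : forall K, polygonal (cell_set K);
  cell_convex : forall K, convex_set (cell_set K);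
  cell_sub : forall K, cell_set K `<=` Omega;
  cell_disjoint : trivIset setT (@cell_set R d D);
  cell_cover : closure Omega = \bigcup_(K in [set: cell D]) closure (cell_set K);
  edge_sub : forall s, edge_set s `<=` closure Omega;
  edge_disjoint : trivIset setT (@edge_set R d D);
  edge_flat : forall s, exists (E : set 'rV[R]_d) K,
    [/\ hyperplane E, edge_set s `<=` boundary (cell_set K) `&` E,
        edge_set s !=set0, relatively_open E (edge_set s)
      & convex_set (edge_set s)];
  edges_ofP : forall K, boundary (cell_set K) =
    \bigcup_(s in [set s | s \in edges_of K]) closure (edge_set s);
  edge_exterior_or_interface :
    forall s, exterior s \/ exists K L, interface s K L;
  center_in : forall K, cell_set K (center K) }.

(* A function of H_D is given by its values on the control volumes, and a      *)
(* family of F_D, indexed by the pairs (K, s) with s in edges_of K, is         *)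
(* extended by zero to all pairs.                                              *)
Definition fluxes (F : {ffun cell D * edge D -> R}) : Prop :=
  forall K s, s \notin edges_of K -> F (K, s) = 0.

Record in_Lnu (nu : cell D -> R) (u : {ffun cell D -> R})
    (v : {ffun cell D -> 'rV[R]_d}) (F : {ffun cell D * edge D -> R}) : Prop :=
  InLnu {
  Lnu_fluxes : fluxes F;
  Lnu_interior : forall K L, neighbours K L -> forall s, interface s K L ->
    dotv (v K) (barycenter (edge_set s) - center K)
    + dotv (v L) (center L - barycenter (edge_set s))
    + nu K * volume (cell_set K) * F (K, s)
    - nu L * volume (cell_set L) * F (L, s) = u L - u K;
  Lnu_exterior : forall K s, s \in edges_of K -> exterior s ->
    dotv (v K) (barycenter (edge_set s) - center K)
    + nu K * volume (cell_set K) * F (K, s) = - u K }.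

Definition mean_matrix (Lambda : 'rV[R]_d -> 'M[R]_d) (A : set 'rV[R]_d) :
    'M[R]_d :=
  \matrix_(i, j)
    ((volume A)^-1 * \int[lebesgue R d]_(x in A) Lambda x i j).

Definition is_solution (Lambda : 'rV[R]_d -> 'M[R]_d) (f : 'rV[R]_d -> R)
    (nu : cell D -> R)
    (w : {ffun cell D -> R} * {ffun cell D -> 'rV[R]_d}
         * {ffun cell D * edge D -> R}) : Prop :=
  let: (u, v, F) := w in
  [/\ in_Lnu nu u v F,
      forall K L s, ~ exterior s -> interface s K L ->
        F (K, s) + F (L, s) = 0,
      forall K,
        volume (cell_set K) *: mxapp (mean_matrix Lambda (cell_set K)) (v K)
        = \sum_(s in edges_of K)
            F (K, s) *: (barycenter (edge_set s) - center K)
    & forall K,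
        - \sum_(s in edges_of K) F (K, s)
        = \int[lebesgue R d]_(x in cell_set K) f x].

End discretization_notions.

(* Main.v *)
Require Import Defs.
From HB Require Import structures.
From mathcomp Require Import all_boot all_order all_algebra.
From mathcomp Require Import all_classical all_reals all_analysis.
From mathcomp Require Import measurable_realfun ring lra.
Import Order.TTheory GRing.Theory Num.Theory.
Import numFieldNormedType.Exports.
Local Open Scope classical_set_scope.
Local Open Scope ring_scope.

(** The scheme is a linear system in (u, v, F) with as many equations as
    unknowns, so that it suffices to show that its homogeneous version has only
    the zero solution.

    To see that the system is square, index the equations other than those of
    the balance and of the definition of v by the pairs (K, s) with s an edge of
    K.  With T_K(s) := v_K.(x_s - x_K) + nu_K m(K) F_(K,s) + u_K, the
    compatibility conditions of L_nu read T_K(s) = 0 on an exterior edge, and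
    T_K(s) = T_L(s) on s = K|L.  An exterior edge gives one equation for each of
    its cells.  An interior edge has exactly two cells K and L, and the pair
    T_K(s) = T_L(s), F_K + F_L = 0 is equivalent to the two equations
    F_K + F_L + T_K(s) - T_L(s) = 0 and F_L + F_K + T_L(s) - T_K(s) = 0, attached
    to (K, s) and (L, s); this avoids orienting the edges.  An exterior edge may
    well separate two cells (Omega may have slits): the condition for K|L is
    then the difference of the two exterior conditions.  The resulting
    endomorphism is [scheme_op], and [scheme_op_bij] is the well-posedness
    statement.

    For a homogeneous solution, taking the scalar product of the equation of v_K
    with v_K, summing over K and regrouping by edges kills the terms in T and in
    u ([energy]): the sum of m(K) Lambda_K v_K.v_K and of nu_K m(K) F_(K,s)^2
    vanishes.  Since m(K) > 0 and Lambda_K is coercive ([volume_gt0],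
    [mean_matrix_coercive]), v = 0 and F = 0.  Then u takes equal values on the
    two sides of an interior edge and vanishes along exterior edges.  It is zero
    ([edge_connected_cells]): from a cell where u does not vanish, follow a line
    that avoids the relative boundaries of all the edges ([generic_line]) up to
    the last point that belongs to the closure of a cell where u is nonzero; this
    point is inside an edge, which is interior, and the cell on its other side
    still has u nonzero and extends beyond that point.

    Two facts on admissible discretizations are behind this. Near a point of an
    edge contained in its closure, a convex cell contains one of the two half
    balls cut by the hyperplane of the edge ([half_ball]), hence an edge lies in
    the closures of at most two cells; and an edge that is the interface of K and
    L belongs to the edges of K and L ([interface_edges_of]).

    The Lebesgue measure of R^n is here given by an outer measure, so that the
    measurability of open sets and the positivity of their volume have to be
    derived from the coverings by boxes ([box_cover_prod],
    [halfspace_measurable]). *)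

Set Implicit Arguments.
Unset Strict Implicit.
Unset Printing Implicit Defensive.

(** * Dot product *)

Section dot_product.
Context (R : realType) (n : nat).
Implicit Types (x y z : 'rV[R]_n) (c : R).

Lemma dotvDl x y z : dotv (x + y) z = dotv x z + dotv y z.
Proof.
by rewrite /dotv -big_split; apply: eq_bigr => i _; rewrite mxE mulrDl.
Qed.

Lemma dotvZl c x z : dotv (c *: x) z = c * dotv x z.
Proof.
by rewrite /dotv mulr_sumr; apply: eq_bigr => i _; rewrite mxE mulrA.
Qed.

Lemma dotvC x y : dotv x y = dotv y x.
Proof. by rewrite /dotv; apply: eq_bigr => i _; rewrite mulrC. Qed.

Lemma dotvDr x y z : dotv x (y + z) = dotv x y + dotv x z.
Proof. by rewrite dotvC dotvDl !(dotvC x). Qed.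

Lemma dotvZr c x z : dotv x (c *: z) = c * dotv x z.
Proof. by rewrite dotvC dotvZl dotvC. Qed.

Lemma dotvNl x z : dotv (- x) z = - dotv x z.
Proof. by rewrite -scaleN1r dotvZl mulN1r. Qed.

Lemma dotvNr x z : dotv x (- z) = - dotv x z.
Proof. by rewrite dotvC dotvNl dotvC. Qed.

Lemma dotv0 x : dotv x 0 = 0.
Proof. by rewrite /dotv big1 // => i _; rewrite mxE mulr0. Qed.

Lemma dotv_sumr (I : finType) (P : pred I) x (f : I -> 'rV[R]_n) :
  dotv x (\sum_(i | P i) f i) = \sum_(i | P i) dotv x (f i).
Proof.
elim/big_rec2: _ => [|i a b _ <-]; last by rewrite dotvDr.
by rewrite dotv0.
Qed.

Lemma dotv_ge0 x : 0 <= dotv x x.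
Proof. by apply: sumr_ge0 => i _; rewrite -expr2 sqr_ge0. Qed.

Lemma dotv_gt0 x : x != 0 -> 0 < dotv x x.
Proof.
move=> x0; rewrite lt0r dotv_ge0 andbT; apply: contra x0.
rewrite /dotv psumr_eq0 => [/allP h|i _]; last by rewrite -expr2 sqr_ge0.
apply/eqP/rowP => i; rewrite mxE.
by have := h i (mem_index_enum _); rewrite -expr2 sqrf_eq0 => /eqP.
Qed.

End dot_product.

(** * The scheme as an endomorphism *)

Section abstract_scheme.
Context (R : realType) (d : nat) (C E : finType).
Variables (inc : C -> {set E}) (ext : pred E) (a : C -> E -> 'rV[R]_d).
Variables (B : C -> 'M[R]_d) (p : C -> R).

(** R^o, rather than R, carries the vector space structure that makes this product
    finite dimensional. *)
Definition unknowns : Type :=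
  ({ffun C -> R^o} * {ffun C -> 'rV[R]_d} * {ffun C * E -> R^o})%type.
HB.instance Definition _ := Vector.on unknowns.

Implicit Types (w : unknowns) (K L : C) (s : E).

(** The value at the barycenter of s of the affine reconstruction of u on K, plus
    the penalization: an exterior condition says that it vanishes, an interior
    one that it is the same from both sides. *)
Definition trace w K s : R :=
  dotv (w.1.2 K) (a K s) + p K * w.2 (K, s) + w.1.1 K.

(** On an interior edge the component at (K, s) is F_K + F_L + T_K - T_L, where L
    is the other cell of s; it is written as a sum over all the cells of s so
    that L needs no name.  Outside the edges of K the component is F itself, as
    the fluxes are extended there by zero. *)
Definition scheme_op w : unknowns :=
  ([ffun K => - \sum_(s in inc K) w.2 (K, s)],
   [ffun K => mxapp (B K) (w.1.2 K) - \sum_(s in inc K) w.2 (K, s) *: a K s],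
   [ffun Ks => if Ks.2 \notin inc Ks.1 then w.2 Ks
     else if ext Ks.2 then trace w Ks.1 Ks.2
     else \sum_(L | Ks.2 \in inc L)
            (w.2 (L, Ks.2) + (if L == Ks.1 then 1 else -1) * trace w L Ks.2)]).

Lemma cell_lin k w w' K :
  (k *: w + w').1.1 K = k * (w.1.1 K : R) + w'.1.1 K :> R.
Proof. by rewrite !ffunE. Qed.

Lemma flux_lin k w w' Ks : (k *: w + w').2 Ks = k * (w.2 Ks : R) + w'.2 Ks :> R.
Proof. by rewrite !ffunE. Qed.

Lemma trace_lin k w w' K s :
  trace (k *: w + w') K s = k * trace w K s + trace w' K s.
Proof. by rewrite /trace cell_lin flux_lin /= !ffunE dotvDl dotvZl; ring. Qed.

Lemma scheme_op_is_linear : linear scheme_op.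
Proof.
move=> k w w'; congr (_, _, _).
- apply/ffunP => K; rewrite !ffunE /= scalerN scaler_sumr -opprD -big_split /=.
  by congr (- _); apply: eq_bigr => s _; rewrite !ffunE.
- apply/ffunP => K; rewrite !ffunE /= /mxapp mulmxDl -scalemxAl.
  rewrite scalerBr addrACA -opprD; congr (_ - _).
  rewrite scaler_sumr -big_split /=; apply: eq_bigr => s _.
  by rewrite !ffunE scalerDl scalerA.
- apply/ffunP => -[K s].
  transitivity (k * ((scheme_op w).2 (K, s) : R) + (scheme_op w').2 (K, s));
    last by rewrite -[LHS]flux_lin.
  rewrite ![(scheme_op _).2 _]ffunE ffunE /=.
  case: ifP => _; first by rewrite !ffunE.
  case: ifP => _; first by rewrite trace_lin.
  rewrite mulr_sumr -big_split; apply: eq_bigr => L _ /=.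
  by rewrite flux_lin trace_lin; ring.
Qed.

HB.instance Definition _ := GRing.isLinear.Build R unknowns unknowns _
  scheme_op scheme_op_is_linear.

Hypothesis two_cells : forall s, ~~ ext s ->
  exists K L, K != L /\ forall M, (s \in inc M) = (M == K) || (M == L).

Lemma interior_op w K L s : ~~ ext s -> K != L -> s \in inc K -> s \in inc L ->
  (scheme_op w).2 (K, s) = w.2 (K, s) + w.2 (L, s) + trace w K s - trace w L s.
Proof.
move=> es KL sK sL; rewrite ffunE /= sK (negbTE es) /=.
have {}KL' : L != K by rewrite eq_sym.
have [K0 [L0 [KL0 h]]] := two_cells es.
rewrite (bigD1 K) //= (bigD1 L) ?sL //= big1 => [|M /andP[/andP[sM MK] ML]].
  by rewrite eqxx (negbTE KL'); ring.
move: sK sL sM; rewrite !h.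
by do 3![move=> /orP[]/eqP ?; subst]; rewrite ?eqxx in KL0 MK ML KL KL' *.
Qed.

Hypothesis B_gt0 : forall K x, x != 0 -> 0 < dotv (mxapp (B K) x) x.
Hypothesis p_gt0 : forall K, 0 < p K.
Hypothesis edge_connected : forall u : C -> R,
  (forall K s, s \in inc K -> ext s -> u K = 0) ->
  (forall K L s, ~~ ext s -> s \in inc K -> s \in inc L -> u K = u L) ->
  forall K, u K = 0.

(** Half the sum and half the difference of the equations attached to the two
    sides of s give back flux conservation and continuity of the trace. *)
Lemma interior_eqs w K L s : ~~ ext s -> K != L -> s \in inc K -> s \in inc L ->
  (scheme_op w).2 (K, s) = 0 -> (scheme_op w).2 (L, s) = 0 ->
  w.2 (K, s) + w.2 (L, s) = 0 /\ trace w K s = trace w L s.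
Proof.
move=> es KL sK sL; have LK : L != K by rewrite eq_sym.
by rewrite (interior_op w es KL sK sL) (interior_op w es LK sL sK); lra.
Qed.

(** Expanding v_K.(x_s - x_K) as T_K(s) - p_K F - u_K, the terms in u disappear by
    the balance in each cell, and those in T edge by edge: T = 0 on an exterior
    edge, while F is antisymmetric and T symmetric across an interior one. *)
Lemma energy w : scheme_op w = 0 ->
  \sum_K dotv (mxapp (B K) (w.1.2 K)) (w.1.2 K)
  + \sum_K \sum_(s in inc K) p K * w.2 (K, s) ^+ 2 = 0.
Proof.
move=> w0.
have w01 K : \sum_(s in inc K) w.2 (K, s) = 0.
  have := congr1 (fun w : unknowns => w.1.1 K) w0.
  by rewrite !ffunE => /eqP; rewrite oppr_eq0 => /eqP.
have w02 K : mxapp (B K) (w.1.2 K) = \sum_(s in inc K) w.2 (K, s) *: a K s.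
  have := congr1 (fun w : unknowns => w.1.2 K) w0.
  by rewrite !ffunE => /eqP; rewrite subr_eq0 => /eqP.
have w03 K s : (scheme_op w).2 (K, s) = 0 by rewrite w0 /= ffunE.
rewrite -big_split /=.
transitivity (\sum_K \sum_(s in inc K) w.2 (K, s) * trace w K s).
  apply: eq_bigr => K _.
  rewrite w02 dotvC dotv_sumr -big_split /=.
  rewrite [RHS](_ : _ = \sum_(s in inc K) w.2 (K, s) * trace w K s
     - w.1.1 K * \sum_(s in inc K) w.2 (K, s)); last by rewrite w01 mulr0 subr0.
  rewrite mulr_sumr -sumrB; apply: eq_bigr => s _.
  by rewrite /trace dotvZr; ring.
rewrite (exchange_big_dep predT) //= big1 // => s _.
have [es|es] := boolP (ext s).
  apply: big1 => K sK; have := w03 K s.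
  by rewrite ffunE /= sK es /= => ->; rewrite mulr0.
have [K [L [KL h]]] := two_cells es.
have sK : s \in inc K by rewrite h eqxx.
have sL : s \in inc L by rewrite h eqxx orbT.
have [FE TE] := interior_eqs es KL sK sL (w03 K s) (w03 L s).
rewrite (bigD1 K) //= (bigD1 L) ?sL 1?eq_sym //= big1 => [|M].
  by rewrite addr0 TE -mulrDl FE mul0r.
by rewrite h => /andP[/andP[/orP[]/eqP->]]; rewrite !eqxx ?andbF.
Qed.

Lemma scheme_op_inj w : scheme_op w = 0 -> w = 0.
Proof.
move=> w0; have := energy w0.
(* Both sums of the energy have nonnegative terms. *)
have posB K : 0 <= dotv (mxapp (B K) (w.1.2 K)) (w.1.2 K).
  have [->|/(B_gt0 K)/ltW//] := eqVneq (w.1.2 K) 0.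
  by rewrite dotv0.
have posp K s : 0 <= p K * w.2 (K, s) ^+ 2.
  by rewrite mulr_ge0 ?sqr_ge0 // ltW.
have posps K : 0 <= \sum_(s in inc K) p K * w.2 (K, s) ^+ 2 by exact: sumr_ge0.
move/eqP; rewrite paddr_eq0 ?sumr_ge0 // !psumr_eq0 //.
move=> /andP[/allP v0 /allP F0].
have {}v0 K : w.1.2 K = 0.
  apply: contraTeq (v0 K (mem_index_enum _)) => /(B_gt0 K).
  by rewrite lt0r => /andP[].
have {}F0 K s : w.2 (K, s) = 0.
  have [sK|sK] := boolP (s \in inc K); last first.
    by have := congr1 (fun w : unknowns => w.2 (K, s)) w0; rewrite !ffunE /= sK.
  have := F0 K (mem_index_enum _); rewrite psumr_eq0 //.
  move=> /allP/(_ s (mem_index_enum _)).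
  by rewrite sK mulf_eq0 gt_eqF //= sqrf_eq0 => /eqP.
have tr K s : trace w K s = w.1.1 K.
  by rewrite /trace v0 F0 mulr0 addr0 dotvC dotv0 add0r.
have w03 K s : (scheme_op w).2 (K, s) = 0 by rewrite w0 /= ffunE.
have u0 : forall K, w.1.1 K = 0.
  apply: edge_connected => [K s sK es|K L s es sK sL].
    by have := w03 K s; rewrite ffunE /= sK es /= tr.
  have [->//|KL] := eqVneq K L.
  by have [_] := interior_eqs es KL sK sL (w03 K s) (w03 L s); rewrite !tr.
case: w {w0 posB posp posps tr w03} v0 F0 u0 => -[u v F] /= v0 F0 u0.
congr (_, _, _); apply/ffunP; first by move=> K; rewrite u0 ffunE.
  by move=> K; rewrite v0 ffunE.
by move=> [K s]; rewrite F0 ffunE.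
Qed.

Lemma scheme_op_bij (b : unknowns) : exists! w, scheme_op w = b.
Proof.
have opE w : linfun scheme_op w = scheme_op w by rewrite lfunE.
have ker0 : lker (linfun scheme_op) == 0%VS.
  rewrite -subv0; apply/subvP => w; rewrite memv_ker opE => /eqP/scheme_op_inj->.
  exact: mem0v.
have : b \in limg (linfun scheme_op) by rewrite lker0_limgf // memvf.
case/memv_imgP => w _ ->; exists w; split; first by rewrite opE.
by move=> w' w'E; apply/(lker0P ker0); rewrite !opE w'E opE.
Qed.

End abstract_scheme.

(** * Lebesgue measure of boxes *)

Lemma countable_enum (T : pointedType) (S : set T) : countable S ->
  exists (P : set nat) (e : nat -> T), set_inj P e /\ e @` P = S.
Proof.
move/countable_bijP => [P]; rewrite card_eq_sym => /card_set_bijP[e [fe ie se]].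
exists P, e; split => //; rewrite eqEsubset; split => // _ [k Pk <-].
exact: fe.
Qed.

(** Countable coverings of a box do not lose volume.  By induction on the
    dimension: for each value t of the first coordinate the slices of the boxes
    that contain t cover the slice of the box, and integrating over t turns the
    induction hypothesis into the claim by monotone convergence.  The
    predicate P selects the boxes, so that slicing amounts to restricting P. *)
Lemma box_cover_prod (R : realType) (n : nat) (lo hi : 'I_n -> R) (P : pred nat)
    (a b : nat -> 'I_n -> R) :
  (forall x : 'I_n -> R, (forall i, lo i <= x i < hi i) ->
     exists2 k, P k & forall i, a k i <= x i < b k i) ->
  ((\prod_i Num.max 0 (hi i - lo i))%:E <=
   \sum_(0 <= k <oo | P k) (\prod_i Num.max 0 (b k i - a k i))%:E)%E.
Proof.
elim: n lo hi P a b => [|n IH] lo hi P a b cov.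
  have [[]//|k Pk _] := cov (fun=> 0).
  apply: (@le_trans _ _ (\sum_(0 <= j < k.+1 | P j)
      (\prod_i Num.max 0 (b j i - a j i))%:E)%E); last first.
    apply: nneseries_lim_ge => j _ _.
    by rewrite lee_fin prodr_ge0 // => i _; rewrite le_max lexx.
  rewrite [leRHS]big_mkcond big_nat_recr //= Pk !big_ord0 leeDr //.
  apply: sume_ge0 => j _; case: ifP => // _.
  by rewrite lee_fin prodr_ge0 // => i _; rewrite le_max lexx.
pose I k : set R := [set` `[a k ord0, b k ord0[].
pose V k : R := \prod_(i < n) Num.max 0 (b k (lift ord0 i) - a k (lift ord0 i)).
pose W : R := \prod_(i < n) Num.max 0 (hi (lift ord0 i) - lo (lift ord0 i)).
pose g k (t : measurableTypeR R) : \bar R :=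
  if P k then ((V k)%:E * (\1_(I k) t)%:E)%E else 0%E.
have V0 k : 0 <= V k by apply: prodr_ge0 => i _; rewrite le_max lexx.
have W0 : 0 <= W by apply: prodr_ge0 => i _; rewrite le_max lexx.
have g0 k t : (0 <= g k t)%E.
  by rewrite /g; case: ifP => // _; rewrite -EFinM lee_fin mulr_ge0.
have mI (x y : R) : measurable [set` `[x, y[] by exact: measurable_itv.
have mg k : measurable_fun [set: measurableTypeR R] (g k).
  rewrite /g; case: (P k); last by [].
  apply: measurable_funeM.
  by apply/measurable_EFinP; apply: measurable_indic; exact: mI.
have len (x y : R) :
    @lebesgue_measure R [set` `[x, y[] = (Num.max 0 (y - x))%:E.
  rewrite lebesgue_measure_itv /= lte_fin; case: ifPn => [xy|].
    by rewrite -EFinB max_r // subr_ge0 ltW.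
  by rewrite -leNgt => yx; rewrite max_l // subr_le0.
have slice (t : measurableTypeR R) :
    (W%:E * (\1_[set` `[lo ord0, hi ord0[] t)%:E <=
    \sum_(0 <= k <oo) g k t)%E.
  rewrite indicE; have [|_] := boolP (t \in _); last first.
    by rewrite mule0; apply: nneseries_ge0.
  rewrite inE /= in_itv /= mule1 => tin.
  rewrite (_ : (\sum_(0 <= k <oo) g k t)%E =
     (\sum_(0 <= k <oo | P k && (a k ord0 <= t < b k ord0)%R) (V k)%:E)%E).
    apply: IH => x xin.
    pose y i := if unlift ord0 i is Some j then x j else t.
    have [i|k Pk yk] := cov y.
      by rewrite /y; case: unliftP => [j|] ->.
    exists k => [|i]; first by have := yk ord0; rewrite /y unlift_none Pk.
    by have := yk (lift ord0 i); rewrite /y liftK.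
  rewrite [RHS]eseries_mkcond; apply: eq_eseriesr => k _.
  rewrite /g indicE; case: (P k) => //=.
  have -> : (t \in I k) = (a k ord0 <= t < b k ord0).
    by apply/idP/idP; rewrite inE /I /= in_itv.
  by case: ifP; rewrite ?mule1 ?mule0.
rewrite big_ord_recl /= mulrC EFinM -len.
rewrite -[X in lebesgue_measure X]setIT -integral_indic //.
rewrite -ge0_integralZl //; last first.
  by apply/measurable_EFinP; apply: measurable_indic; exact: mI.
apply: (@le_trans _ _
    (\int[lebesgue_measure]_t (\sum_(0 <= k <oo) g k t))%E).
  apply: ge0_le_integral => //.
  - by move=> t _; rewrite mule_ge0 // lee_fin.
  - apply: measurable_funeM.
    by apply/measurable_EFinP; apply: measurable_indic; exact: mI.
  - have := @ge0_emeasurable_sum _ _ _ [set: measurableTypeR R] g xpredT.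
    by apply.
rewrite integral_nneseries // [leRHS]eseries_mkcond le_eqVlt; apply/orP; left.
apply/eqP/eq_eseriesr => k _; rewrite /g; case: (P k); last exact: integral0_eq.
rewrite ge0_integralZl // ?lee_fin //; last first.
  by apply/measurable_EFinP; apply: measurable_indic; exact: mI.
have mIk : measurable (I k) by exact: mI.
by rewrite integral_indic // setIT [X in (_ * X)%E]len big_ord_recl /= -EFinM mulrC.
Qed.

Section lebesgue_outer_boxes.
Context (R : realType) (n : nat).
Implicit Types (X : set 'rV[R]_n) (I : 'rV[R]_n * 'rV[R]_n).
Local Notation boxes := (set ('rV[R]_n * 'rV[R]_n)).
Local Open Scope ereal_scope.

Lemma lebesgue_outer_box_le I : lebesgue_outer (box I) <= (box_volume I)%:E.
Proof.
apply: ereal_inf_lbound; exists [set I]; last by rewrite esum_set1 ?box_volume_ge0.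
by split; [exact: countable1|move=> x Ix; exists I].
Qed.

Lemma le_lebesgue_outer_box I : (box_volume I)%:E <= lebesgue_outer (box I).
Proof.
apply: le_ereal_inf_tmp => _ [S [cS BS] <-].
have [P [e [inje SE]]] := countable_enum cS.
rewrite -SE esum_set_image //; last by move=> k _; exact: box_volume_ge0.
apply: (box_cover_prod (lo := I.1 ord0) (hi := I.2 ord0) (P := mem P)
  (a := fun k => (e k).1 ord0) (b := fun k => (e k).2 ord0)) => x xI.
have [|J] := BS (\row_i x i); first by move=> i; rewrite mxE.
rewrite -SE => -[k Pk <-] h; exists k; first exact: mem_set.
by move=> i; have := h i; rewrite mxE.
Qed.

(** The boxes used in the covering are modifications g of those of S, so that
    cutting the boxes of a covering yields coverings again, although distinct
    boxes may have the same image by g. *)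
Lemma lebesgue_outer_le_cover X (S : boxes) (g : 'rV[R]_n * 'rV[R]_n -> _) :
  countable S -> X `<=` \bigcup_(I in S) box (g I) ->
  lebesgue_outer X <= \esum_(I in S) (box_volume (g I))%:E.
Proof.
move=> cS XS; have [P [e [inje SE]]] := countable_enum cS.
rewrite -SE esum_set_image //; last by move=> k _; exact: box_volume_ge0.
pose A k := if k \in P then box (g (e k)) else set0.
apply: (@le_trans _ _ (lebesgue_outer (\bigcup_k A k))).
  apply: le_lebesgue_outer => x /XS[_ /[!(esym SE)] -[k Pk <-] kx].
  by exists k => //; rewrite /A mem_set.
apply: le_trans (lebesgue_outer_sigma_subadditive _) _.
rewrite [leRHS]eseries_mkcond; apply: lee_nneseries => k _ => [_|].
  exact: lebesgue_outer_ge0.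
by rewrite /A; case: ifP => _; [exact: lebesgue_outer_box_le|rewrite lebesgue_outer0].
Qed.

Definition box_below (i : 'I_n) (c : R) I : 'rV[R]_n * 'rV[R]_n :=
  (I.1, \row_j if j == i then Num.min (I.2 ord0 j) c else I.2 ord0 j).

Definition box_above (i : 'I_n) (c : R) I : 'rV[R]_n * 'rV[R]_n :=
  (\row_j (if j == i then Num.max (I.1 ord0 j) c else I.1 ord0 j), I.2).

Lemma box_volume_cut (i : 'I_n) (c : R) I :
  (box_volume (box_below i c I) + box_volume (box_above i c I) = box_volume I)%R.
Proof.
rewrite /box_volume (bigD1 i) //= [X in (_ + X)%R](bigD1 i) //= [RHS](bigD1 i) //=.
rewrite !mxE eqxx.
rewrite (eq_bigr (fun j => Num.max 0 (I.2 ord0 j - I.1 ord0 j))%R); last first.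
  by move=> j /negbTE ji; rewrite mxE ji.
rewrite [in X in (_ + X)%R](eq_bigr
  (fun j => Num.max 0 (I.2 ord0 j - I.1 ord0 j))%R); last first.
  by move=> j /negbTE ji; rewrite mxE ji.
rewrite -mulrDl; congr (_ * _)%R.
set x := I.1 ord0 i; set y := I.2 ord0 i.
by case: (leP y c) => ?; case: (leP x c) => ?; do ![case: (leP 0%R _) => ?]; lra.
Qed.

(** A coordinate hyperplane cuts each box of a covering into two boxes whose
    volumes add up, which is Caratheodory's criterion. *)
Lemma halfspace_measurable (i : 'I_n) (c : R) :
  (lebesgue_outer_measure R n).-caratheodory [set x | (x ord0 i < c)%R].
Proof.
apply: le_caratheodory_measurable => X; apply: le_ereal_inf_tmp => _ [S [cS XS] <-].
rewrite (eq_esum (fun I _ => congr1 EFin (esym (box_volume_cut i c I)))).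
under eq_esum do rewrite EFinD.
rewrite esumD => [|I _|I _]; [|exact: box_volume_ge0|exact: box_volume_ge0].
apply: leeD; apply: lebesgue_outer_le_cover => // x [/XS[I SI Ix] xc]; exists I => //.
  move=> j; have := Ix j; rewrite /= mxE; case: eqP => // -> /andP[-> ?] /=.
  by rewrite lt_min; apply/andP.
move=> j; have := Ix j; rewrite /= mxE; case: eqP => // -> /andP[? ->] /=.
by rewrite andbT ge_max; apply/andP; split => //; rewrite leNgt; apply/negP.
Qed.

Lemma box_measurable I : measurable (box I : set (lebesgue_space R n)).
Proof.
have -> : box I = \bigcap_(i in [set: 'I_n])
    ([set x | (x ord0 i < I.2 ord0 i)%R] `\` [set x | (x ord0 i < I.1 ord0 i)%R]).
  rewrite eqEsubset; split => x h i /=.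
    by move=> _; have /andP[h1 h2] := h i; split => //; apply/negP; rewrite -leNgt.
  by have [/= -> /negP] := h i Logic.I; rewrite -leNgt => ->.
apply: (@fin_bigcap_measurable _ (lebesgue_space R n)) => [|i _].
  exact: finite_finset.
by apply: measurableD; exact: halfspace_measurable.
Qed.

End lebesgue_outer_boxes.

Lemma mx_entry_le (R : realType) (m n : nat) (A : 'M[R]_(m, n)) i j :
  `|A i j| <= `|A|.
Proof.
rewrite [leRHS]mx_normrE.
exact: (le_bigmax _ (fun ij : 'I_m * 'I_n => `|A ij.1 ij.2|) (i, j)).
Qed.

(** * Open sets and mean matrices *)

Section lebesgue_open.
Context (R : realType) (n : nat).
Implicit Types (U : set 'rV[R]_n).

Lemma open_rV_ball U x : open U -> U x ->
  exists2 e : R, 0 < e & forall y : 'rV[R]_n,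
    (forall i, `|x ord0 i - y ord0 i| < e) -> U y.
Proof.
move=> oU Ux; have /nbhs_ballP[e /= e0 eU] : nbhs x U by exact: open_nbhs_nbhs.
exists e => // y xy; apply: eU; split => // i j.
by rewrite (ord1 i) -ball_normE /=.
Qed.

(** An open set is the union of the boxes with rational vertices that it
    contains. *)
Lemma open_lebesgue_measurable U : open U -> measurable (U : set (lebesgue_space R n)).
Proof.
move=> oU.
pose J (q : 'rV[rat]_n * 'rV[rat]_n) : 'rV[R]_n * 'rV[R]_n :=
  (map_mx ratr q.1, map_mx ratr q.2).
have -> : U = \bigcup_(q in [set: 'rV[rat]_n * 'rV[rat]_n])
    (if `[< box (J q) `<=` U >] then box (J q) else set0).
  rewrite eqEsubset; split => x; last first.
    by move=> [q _]; case: asboolP => // qU /qU.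
  move=> Ux; have [e e0 eU] := open_rV_ball oU Ux.
  have [p pP] : {p : 'I_n -> rat & forall i, x ord0 i - e < ratr (p i) < x ord0 i}.
    apply: (@choice _ _ (fun i r => x ord0 i - e < ratr r < x ord0 i)) => i.
    have [|q] := @rat_in_itvoo R (x ord0 i - e) (x ord0 i); first by lra.
    by rewrite in_itv; exists q.
  have [q qP] : {p : 'I_n -> rat & forall i, x ord0 i < ratr (p i) < x ord0 i + e}.
    apply: (@choice _ _ (fun i r => x ord0 i < ratr r < x ord0 i + e)) => i.
    have [|r] := @rat_in_itvoo R (x ord0 i) (x ord0 i + e); first by lra.
    by rewrite in_itv; exists r.
  exists (\row_i p i, \row_i q i) => //.
  case: asboolP => [_ i|[]]; rewrite /J /=.
    by rewrite !mxE; have := pP i; have := qP i; lra.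
  move=> y yb; apply: eU => i; have := yb i; rewrite !mxE.
  by have := pP i; have := qP i; rewrite ltr_norml; lra.
apply: (@countable_bigcupT_measurable _ (lebesgue_space R n)).
  exact: countableP.
by move=> q; case: ifP => _; [exact: box_measurable|exact: measurable0].
Qed.

Lemma bounded_lebesgue_lty U : bounded_set U -> (lebesgue R n U < +oo)%E.
Proof.
move=> /= [M [_ /(_ (M + 1))]]; rewrite ltrDl ltr01 => /(_ isT) UM.
set r := M + 1 in UM.
apply: (@le_lt_trans _ _ (lebesgue_outer
    (box (const_mx (- r) : 'rV[R]_n, const_mx (r + 1) : 'rV[R]_n)))).
  apply: le_lebesgue_outer => x /UM xr i; rewrite /= !mxE.
  have : `|x ord0 i| <= r by apply: le_trans xr; exact: mx_entry_le.
  by rewrite ler_norml; lra.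
by apply: le_lt_trans (lebesgue_outer_box_le _) _; rewrite ltry.
Qed.

Lemma open_lebesgue_gt0 U : open U -> U !=set0 -> (0 < lebesgue R n U)%E.
Proof.
move=> oU [x Ux]; have [e e0 eU] := open_rV_ball oU Ux.
pose I : 'rV[R]_n * 'rV[R]_n := (x, \row_i (x ord0 i + e)).
apply: (@lt_le_trans _ _ (lebesgue_outer (box I))).
  apply: lt_le_trans (le_lebesgue_outer_box _); rewrite lte_fin.
  by apply: prodr_gt0 => i _; rewrite /= mxE lt_max addrAC subrr add0r e0 orbT.
apply: le_lebesgue_outer => y yI; apply: eU => i.
by have := yI i; rewrite /= mxE ltr_norml; lra.
Qed.

Lemma volume_gt0 U : open U -> U !=set0 -> bounded_set U -> 0 < volume U.
Proof.
move=> oU U0 bU; rewrite /volume fine_gt0 // open_lebesgue_gt0 //=.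
exact: bounded_lebesgue_lty.
Qed.

End lebesgue_open.

(** The quadratic form of the left-hand side is the integral over K of
    Lambda(x) xi.xi, as m(K) compensates the normalization of the mean. *)
Lemma mean_matrix_coercive (R : realType) (d : nat) (Lambda : 'rV[R]_d -> 'M[R]_d)
    (alpha0 : R) (K : set 'rV[R]_d) :
  0 <= alpha0 -> open K -> K !=set0 -> bounded_set K ->
  [bounded Lambda x | x in K] ->
  (forall i j, measurable_fun (K : set (lebesgue_space R d)) (fun x => Lambda x i j)) ->
  {ae lebesgue R d, forall x, K x -> forall xi : 'rV[R]_d,
       alpha0 * dotv xi xi <= dotv (mxapp (Lambda x) xi) xi} ->
  forall xi : 'rV[R]_d,
  alpha0 * volume K * dotv xi xi <=
    dotv (mxapp (volume K *: mean_matrix Lambda K) xi) xi.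
Proof.
move=> alpha0_ge0 oK K0 bK bL mL cL xi.
have mK := open_lebesgue_measurable oK.
have finK := bounded_lebesgue_lty bK.
have vK := volume_gt0 oK K0 bK.
have iL i j : (lebesgue R d).-integrable K (EFin \o (fun x => Lambda x i j)).
  apply: measurable_bounded_integrable => //.
  move: bL => [M [rM hM]]; exists M; split => // r Mr x Kx.
  apply: le_trans (hM r Mr x Kx); exact: mx_entry_le.
pose g (x : lebesgue_space R d) : R :=
  \sum_i \sum_j (xi ord0 i * xi ord0 j) * Lambda x i j.
have gE x : g x = dotv (mxapp (Lambda x) xi) xi.
  rewrite /g /dotv; apply: eq_bigr => i _; rewrite /mxapp mxE mulr_suml.
  by apply: eq_bigr => j _; rewrite mxE; ring.
have ig : (lebesgue R d).-integrable K (EFin \o g).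
  rewrite (_ : EFin \o g = fun x => (\sum_i \sum_j
      (xi ord0 i * xi ord0 j)%:E * (Lambda x i j)%:E)%E).
    apply: integrable_sum => // i _; apply: integrable_sum => // j _.
    by apply: integrableZl => //; exact: iL.
  apply/funext => x; rewrite /g /= -sumEFin; apply: eq_bigr => i _.
  by rewrite -sumEFin; apply: eq_bigr => j _; rewrite EFinM.
have intg : (\int[lebesgue R d]_(x in K) (g x)%:E =
    (dotv (mxapp (volume K *: mean_matrix Lambda K) xi) xi)%:E)%E.
  transitivity (\int[lebesgue R d]_(x in K) (\sum_i \sum_j
      (xi ord0 i * xi ord0 j)%:E * (Lambda x i j)%:E))%E.
    apply: eq_integral => x _; rewrite /g -sumEFin; apply: eq_bigr => i _.
    by rewrite -sumEFin; apply: eq_bigr => j _; rewrite EFinM.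
  rewrite integral_sum //; last first.
    move=> i; apply: integrable_sum => // j _.
    by apply: integrableZl => //; exact: iL.
  rewrite -sumEFin; apply: eq_bigr => i _.
  rewrite integral_sum //; last first.
    by move=> j; apply: integrableZl => //; exact: iL.
  rewrite /mxapp mxE mulr_suml -sumEFin; apply: eq_bigr => j _.
  rewrite integralZl //; last exact: iL.
  rewrite !mxE mulVKf ?gt_eqF // /Rintegral -[X in (_ * X)%E]fineK; last first.
    exact: integrable_fin_num (iL i j).
  by rewrite -EFinM; congr EFin; ring.
(* The bound by c holds almost everywhere only: replacing g by its maximum with c
   does not change the integral. *)
set c := alpha0 * dotv xi xi.
have c0 : 0 <= c by rewrite mulr_ge0 ?dotv_ge0.
have mg : measurable_fun (K : set (lebesgue_space R d)) g by apply/measurable_EFinP/(measurable_int _ ig).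
rewrite -lee_fin -intg.
rewrite (@ae_eq_integral _ _ _ (lebesgue R d) K (EFin \o (g \max cst c)) (EFin \o g)) //.
- rewrite (_ : (_ * _)%:E = (\int[lebesgue R d]_(x in K) (cst c%:E) x)%E).
    apply: ge0_le_integral => //.
    + by apply/measurable_EFinP; exact: measurable_maxr.
    + by move=> x Kx; rewrite lee_fin /= le_max lexx orbT.
  rewrite integral_cst // -[X in (_ * X)%E]fineK ?ge0_fin_numE //.
  by rewrite -EFinM; congr EFin; rewrite /c /volume; ring.
- exact/measurable_EFinP.
- by apply/measurable_EFinP; exact: measurable_maxr.
- case: cL => N [mN N0 subN]; exists N; split => // x notx; apply: subN => cLx.
  by apply: notx => Kx /=; rewrite max_l // gE; exact: cLx.
Qed.

(** * Convex cells and faces *)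

Section faces.
Context (R : realType) (n : nat).
Implicit Types (x y k l w e : 'rV[R]_n) (c : R) (K L M U V : set 'rV[R]_n).

Definition flat w c : set 'rV[R]_n := [set x | dotv x w = c].

Lemma dotv_continuous w : continuous (fun x => dotv x w).
Proof.
suff key (x : 'rV[R]_n) (s : seq 'I_n) :
    (fun y : 'rV[R]_n => \sum_(i <- s) y ord0 i * w ord0 i) @ x
    --> \sum_(i <- s) x ord0 i * w ord0 i by move=> x; exact: key.
elim: s => [|i s IH].
  rewrite big_nil (_ : (fun _ => _) = cst 0); first exact: cst_continuous.
  by apply/funext => y; rewrite big_nil.
rewrite big_cons (_ : (fun _ => _) = (fun y : 'rV[R]_n => y ord0 i * w ord0 i) \+
    (fun y : 'rV[R]_n => \sum_(j <- s) y ord0 j * w ord0 j)); last first.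
  by apply/funext => y; rewrite big_cons.
apply: cvgD IH; apply: cvgM; last exact: cst_continuous.
exact: coord_continuous.
Qed.

Lemma flat_closed w c : closed (flat w c).
Proof.
rewrite (_ : flat w c = (fun x => dotv x w) @^-1` [set c]) //.
by apply: preimage_closed => [x _|]; [exact: dotv_continuous|exact: closed_eq].
Qed.

Lemma near_ray x e (P : set 'rV[R]_n) :
  nbhs x P -> exists2 t : R, 0 < t <= 1 & P (x + t *: e).
Proof.
move=> xP.
have cv : x + t *: e @[t --> (0 : R)^'+] --> x + (0 : R) *: e.
  apply: cvg_at_right_filter; apply: cvgD; first exact: cst_continuous.
  by apply: cvgZ; [exact: cvg_id|exact: cst_continuous].
rewrite scale0r addr0 in cv.
have := cv _ xP; rewrite /= => nP.
near (0 : R)^'+ => t; exists t; last by near: t.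
apply/andP; split; near: t; first exact: nbhs_right_gt.
by apply: nbhs_right_le; exact: ltr01.
Unshelve. all: by end_near. Qed.

Lemma convex_setP K x y (t : R) : convex_set K -> K x -> K y -> 0 <= t <= 1 ->
  K (t *: x + (1 - t) *: y).
Proof.
move=> cK Kx Ky /andP[t0 t1].
by have := cK x y (Itv01 t0 t1); rewrite !inE; apply.
Qed.

(** Moving x to a point y of K close to it is compensated by moving k by
    (1 - t) / t times x - y, which stays in K. *)
Lemma convex_segment K x k (t : R) : convex_set K -> open K ->
  closure K x -> K k -> 0 < t <= 1 -> K ((1 - t) *: x + t *: k).
Proof.
move=> cK oK Kx Kk /andP[t0 t1].
have /nbhs_ballP[r /= r0 rK] : nbhs k K by exact: open_nbhs_nbhs.
have [y [Ky]] := Kx _ (nbhsx_ballx x (r * t) (mulr_gt0 r0 t0)).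
rewrite -ball_normE /= => xy.
pose k' := k + ((1 - t) / t) *: (x - y).
have Kk' : K k'.
  apply: rK; rewrite -ball_normE /= opprD addrA subrr add0r normrN normrZ.
  rewrite ger0_norm ?divr_ge0 ?subr_ge0 ?(ltW t0) //.
  apply: (@le_lt_trans _ _ (t^-1 * `|x - y|)).
    apply: ler_wpM2r => //; apply: ler_piMl; last by lra.
    by rewrite invr_ge0 ltW.
  by rewrite mulrC ltr_pdivrMr.
have := convex_setP cK Kk' Ky; move=> /(_ t); rewrite ltW //= t1 => /(_ isT).
congr K; rewrite /k' scalerDr scalerA mulrCA divff ?gt_eqF // mulr1.
by rewrite scalerBr -addrA subrK addrC.
Qed.

(** K contains a half ball centred at x, on the side of k: a point y close to x on
    that side lies on a segment from k to the point b(y) where the line through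
    k and y meets the hyperplane; b is continuous with b(x) = x, so that b(y) is
    in the face, hence in the closure of K. *)
Lemma half_ball K U w c x k : convex_set K -> open K -> open U ->
  flat w c `&` U `<=` closure K -> (flat w c `&` U) x -> K k -> dotv k w != c ->
  \forall y \near x, 0 < (dotv y w - c) * (dotv k w - c) -> K y.
Proof.
move=> cK oK oU EUK [xw Ux] Kk kw.
pose h := dotv k w - c; have h0 : h != 0 by rewrite subr_eq0.
(* t and b are defined so that y = (1 - t y) b(y) + t y k with b(y) on the
   hyperplane. *)
pose t y := (dotv y w - c) / h.
pose b y := (1 - t y)^-1 *: (y - t y *: k).
have tx : t x = 0 by rewrite /t xw subrr mul0r.
have ct : t y @[y --> x] --> 0.
  rewrite -tx; apply: (cvgM (F := nbhs x)); last exact: cst_continuous.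
  by apply: (cvgB (F := nbhs x)); [exact: dotv_continuous|exact: cst_continuous].
have cb : b y @[y --> x] --> (1 - 0)^-1 *: (x - (0 : R) *: k).
  apply: (cvgZ (F := nbhs x)); last first.
    apply: (cvgB (F := nbhs x)); first exact: cvg_id.
    by apply: (cvgZ (F := nbhs x)); [exact: ct|exact: cst_continuous].
  apply: (cvgV (F := nbhs x)); first by rewrite subr0 oner_neq0.
  by apply: (cvgB (F := nbhs x)); [exact: cst_continuous|exact: ct].
rewrite subr0 invr1 scale1r scale0r subr0 in cb.
have t_lt1 : \forall y \near x, t y < 1.
  by apply: (cvgr_lt 0 ct); exact: ltr01.
have Ub : \forall y \near x, U (b y) by apply: cb; exact: open_nbhs_nbhs.
apply: filterS2 t_lt1 Ub => y ty1 Uby yw.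
have ty0 : 0 < t y.
  have -> : t y = (dotv y w - c) * h / h ^+ 2 by rewrite /t; field.
  by rewrite divr_gt0 // exprn_even_gt0.
have t1 : 1 - t y != 0 by rewrite subr_eq0 gt_eqF.
have -> : y = (1 - t y) *: b y + t y *: k.
  by rewrite /b scalerA divff // scale1r subrK.
apply: convex_segment => //; last by rewrite ty0 ltW.
apply: EUK; split => //; rewrite /flat /= /b dotvZl dotvDl dotvNl dotvZl.
apply: (mulfI t1); rewrite mulrA divff // mul1r.
have : t y * h = dotv y w - c by rewrite /t divfK.
by rewrite /h; lra.
Qed.

Lemma off_flat K w c : open K -> K !=set0 -> w != 0 ->
  exists2 k, K k & dotv k w != c.
Proof.
move=> oK [k Kk] w0; have [kw|kw] := eqVneq (dotv k w) c; last by exists k.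
have [t /andP[t0 _] Kt] := near_ray w (open_nbhs_nbhs (conj oK Kk)).
exists (k + t *: w) => //.
by rewrite dotvDl dotvZl kw addrC -subr_eq0 addrK mulf_neq0 // gt_eqF // dotv_gt0.
Qed.

Lemma same_side_meet K L U w c x k l :
  convex_set K -> open K -> convex_set L -> open L -> open U ->
  flat w c `&` U `<=` closure K -> flat w c `&` U `<=` closure L ->
  (flat w c `&` U) x -> K k -> L l ->
  0 < (dotv k w - c) * (dotv l w - c) -> K `&` L !=set0.
Proof.
move=> cK oK cL oL oU EK EL EUx Kk Ll kl.
have lw : dotv l w != c by apply: contraTneq kl => ->; rewrite subrr mulr0 ltxx.
have [t /andP[t0 t1] Lt] := near_ray (k - x) (half_ball cL oL oU EL EUx Ll lw).
have xE : x + t *: (k - x) = (1 - t) *: x + t *: k.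
  by rewrite scalerBr scalerBl scale1r addrAC addrA.
exists (x + t *: (k - x)); split.
  by rewrite xE; apply: convex_segment; rewrite ?t0 //; exact: EK.
apply: Lt; rewrite dotvDl dotvZl dotvDl dotvNl EUx.1.
by rewrite (addrC c) addrK -mulrA mulr_gt0.
Qed.

Lemma opposite_sides K L U w c x k l :
  convex_set K -> open K -> convex_set L -> open L -> open U ->
  flat w c `&` U `<=` closure K -> flat w c `&` U `<=` closure L ->
  (flat w c `&` U) x -> K k -> L l -> dotv k w != c -> dotv l w != c ->
  K `&` L = set0 -> (dotv k w - c) * (dotv l w - c) < 0.
Proof.
move=> cK oK cL oL oU EK EL EUx Kk Ll kw lw KL0.
rewrite lt_neqAle mulf_eq0 !subr_eq0 (negbTE kw) (negbTE lw) /= leNgt.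
apply/negP => kl.
by have := same_side_meet cK oK cL oL oU EK EL EUx Kk Ll kl; rewrite KL0 => -[].
Qed.

(** Each of three cells fills one of the two half balls at a point of the face, so
    two of them fill the same one. *)
Lemma third_cell_meets K L M U w c :
  w != 0 -> open U -> flat w c `&` U !=set0 ->
  convex_set K -> open K -> K !=set0 -> flat w c `&` U `<=` closure K ->
  convex_set L -> open L -> L !=set0 -> flat w c `&` U `<=` closure L ->
  convex_set M -> open M -> M !=set0 -> flat w c `&` U `<=` closure M ->
  K `&` L = set0 -> K `&` M = set0 -> L `&` M !=set0.
Proof.
move=> w0 oU [x EUx] cK oK K0 EK cL oL L0 EL cM oM M0 EM KL KM.
have [k Kk kw] := off_flat c oK K0 w0.
have [l Ll lw] := off_flat c oL L0 w0.
have [m Mm mw] := off_flat c oM M0 w0.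
have kl := opposite_sides cK oK cL oL oU EK EL EUx Kk Ll kw lw KL.
have km := opposite_sides cK oK cM oM oU EK EM EUx Kk Mm kw mw KM.
apply: (same_side_meet cL oL cM oM oU EL EM EUx Ll Mm).
have k2 : 0 < (dotv k w - c) ^+ 2 by rewrite exprn_even_gt0 //= subr_eq0.
have : 0 < (dotv k w - c) * (dotv l w - c) * ((dotv k w - c) * (dotv m w - c)).
  by rewrite nmulr_rgt0.
by rewrite mulrACA -expr2 pmulr_rgt0.
Qed.

(** The two cells fill opposite half balls, and the face fills the hyperplane. *)
Lemma two_cells_nbhs K L U w c x :
  w != 0 -> open U -> (flat w c `&` U) x ->
  convex_set K -> open K -> K !=set0 -> flat w c `&` U `<=` closure K ->
  convex_set L -> open L -> L !=set0 -> flat w c `&` U `<=` closure L ->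
  K `&` L = set0 -> nbhs x (closure K `|` closure L).
Proof.
move=> w0 oU EUx cK oK K0 EK cL oL L0 EL KL.
have [k Kk kw] := off_flat c oK K0 w0.
have [l Ll lw] := off_flat c oL L0 w0.
have kl := opposite_sides cK oK cL oL oU EK EL EUx Kk Ll kw lw KL.
have nU : nbhs x U by exact: open_nbhs_nbhs (conj oU EUx.2).
apply: filterS3 nU (half_ball cK oK oU EK EUx Kk kw)
  (half_ball cL oL oU EL EUx Ll lw) => y Uy yK yL.
have [yw|yw] := eqVneq (dotv y w) c; first by left; exact: EK.
have [yk|yk] := ltP 0 ((dotv y w - c) * (dotv k w - c)).
  by left; apply: subset_closure; exact: yK.
right; apply: subset_closure; apply: yL.
have : dotv y w - c != 0 by rewrite subr_eq0.
by move: kl yk; case: (ltgtP (dotv y w - c) 0) => // h; nra.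
Qed.

(** The component z of w' orthogonal to w is a direction of the first
    hyperplane, and following it does not change the dot product with w'. *)
Lemma flat_eq w w' c c' V : w != 0 -> w' != 0 -> open V ->
  flat w c `&` V !=set0 -> flat w c `&` V `<=` flat w' c' -> flat w c = flat w' c'.
Proof.
move=> w0 w'0 oV [x [xw Vx]] sub.
have ww : dotv w w != 0 by rewrite gt_eqF // dotv_gt0.
pose lam := dotv w' w / dotv w w; pose z := w' - lam *: w.
have zw : dotv z w = 0 by rewrite dotvDl dotvNl dotvZl divfK // subrr.
have xw' : dotv x w' = c' by apply: sub.
have [t /andP[t0 _] Vt] := near_ray z (open_nbhs_nbhs (conj oV Vx)).
have : flat w' c' (x + t *: z).
  by apply: sub; split => //; rewrite /flat /= dotvDl dotvZl zw mulr0 addr0.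
rewrite /flat /= dotvDl dotvZl xw' => /eqP.
rewrite addrC -subr_eq0 addrK mulf_eq0 gt_eqF //= => /eqP zw'.
have z0 : z = 0.
  apply: contra_eq (_ : dotv z z = 0) => [/dotv_gt0|]; first by rewrite lt0r => /andP[].
  by rewrite {2}/z dotvDr dotvNr dotvZr zw zw' mulr0 subr0.
have w'E : w' = lam *: w by apply/eqP; rewrite -subr_eq0 -/z z0.
have lam0 : lam != 0 by apply: contraNneq w'0 => l0; rewrite w'E l0 scale0r.
have c'E : c' = lam * c by rewrite -xw' w'E dotvZr xw.
rewrite w'E c'E; apply/seteqP; split => y; rewrite /flat /= dotvZr; first by move->.
by move/(mulfI lam0).
Qed.

(** A finite form of Baire's theorem in a hyperplane: if U is not within the first
    closed set, what remains of U is covered by the others. *)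
Lemma closed_cover_flat (I : eqType) (s : seq I) (C : I -> set 'rV[R]_n) w c U :
  (forall i, closed (C i)) -> open U -> flat w c `&` U !=set0 ->
  flat w c `&` U `<=` \bigcup_(i in [set i | i \in s]) C i ->
  exists i V, [/\ i \in s, open V, V `<=` U, flat w c `&` V !=set0
                & flat w c `&` V `<=` C i].
Proof.
move=> clC; elim: s U => [|i s IH] U oU U0 UC.
  by have [x /UC[j /=]] := U0; rewrite in_nil.
have [sub|nsub] := pselect (flat w c `&` U `<=` C i).
  by exists i, U; split => //; rewrite mem_head.
have [||x [Ex [Ux nCx]]|j [V [js oV VU V0 VC]]] := IH (U `&` ~` C i).
- by apply: openI => //; exact: closed_openC.
- have /existsNP[x /not_implyP[[Ex Ux] nCx]] := nsub.
  by exists x; split.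
- have [j] := UC x (conj Ex Ux); rewrite /= inE => /orP[/eqP-> //|js Cj].
  by exists j.
- exists j, V; split => //; first by rewrite inE js orbT.
  by move=> y /VU[].
Qed.

Lemma faces_meet w c U w' c' U' V : w != 0 -> w' != 0 -> open V -> V `<=` U ->
  flat w c `&` V !=set0 -> flat w c `&` V `<=` closure (flat w' c' `&` U') ->
  (flat w c `&` U) `&` (flat w' c' `&` U') !=set0.
Proof.
move=> w0 w'0 oV VU V0 sub.
have flatE : flat w c = flat w' c'.
  apply: flat_eq V0 _ => // x /sub /closure_subset -/(_ (flat w' c')) h.
  rewrite (closure_id (flat w' c')).1; last exact: flat_closed.
  by apply: h => y [].
have [x Ex] := V0; have [y [[E'y U'y] Vy]] := sub x Ex _ (open_nbhs_nbhs (conj oV Ex.2)).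
by exists y; split; split => //; [rewrite flatE|exact: VU].
Qed.

(** Almost all lines of direction e avoid the relative boundary of a face.  If e is
    parallel to the hyperplane, take a off the hyperplane.  Otherwise let p be
    the projection onto the hyperplane along e; points a where p(a) is in the
    face or off its closure form an open set, and a translation that brings p(a)
    into the face shows that it is not empty. *)
Lemma generic_line w c U e V : w != 0 -> open U -> open V -> V !=set0 ->
  exists W, [/\ open W, W !=set0, W `<=` V & forall a t, W a ->
    ~ (closure (flat w c `&` U) `\` (flat w c `&` U)) (a + t *: e)].
Proof.
move=> w0 oU oV V0; set F := flat w c `&` U.
have clF : closure F `<=` flat w c.
  rewrite [X in _ `<=` X](closure_id (flat w c)).1; last exact: flat_closed.
  by apply: closure_subset => y [].
have [ew|ew] := eqVneq (dotv e w) 0.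
  have [k Vk kw] := off_flat c oV V0 w0.
  exists (V `&` ~` flat w c); split.
  - by apply: openI => //; apply: closed_openC; exact: flat_closed.
  - by exists k; split => // /eqP; exact/negP.
  - by move=> ? [].
  - move=> a t [_ nEa] [/clF]; rewrite /flat /= dotvDl dotvZl ew mulr0 addr0.
    by move=> /nEa.
pose p a := a + ((c - dotv a w) / dotv e w) *: e.
have pE a : flat w c (p a).
  by rewrite /flat /= dotvDl dotvZl divfK // addrC subrK.
have pF a t : flat w c (a + t *: e) -> p a = a + t *: e.
  rewrite /flat /= dotvDl dotvZl => h; rewrite /p; congr (_ + _ *: _).
  by apply: (mulIf ew); rewrite divfK // -h; ring.
have cp : continuous p.
  move=> a; apply: (cvgD (F := nbhs a)); first exact: cvg_id.
  apply: (cvgZ (F := nbhs a)); last exact: cst_continuous.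
  apply: (cvgM (F := nbhs a)); last exact: cst_continuous.
  by apply: (cvgB (F := nbhs a)); [exact: cst_continuous|exact: dotv_continuous].
exists (V `&` p @^-1` (U `|` ~` closure F)); split.
- apply: openI => //; apply: open_comp => [a _|]; first exact: cp.
  by apply: openU => //; apply: closed_openC; exact: closed_closure.
- have [a Va] := V0; have [Fpa|] := pselect (closure F (p a)); last first.
    by move=> h; exists a; split => //; right.
  have nV : nbhs (p a) [set z | V (a + (z - p a))].
    have cz : (a + (z - p a)) @[z --> p a] --> a + (p a - p a).
      apply: (cvgD (F := nbhs (p a))); first exact: cst_continuous.
      by apply: (cvgB (F := nbhs (p a))); [exact: cvg_id|exact: cst_continuous].
    rewrite subrr addr0 in cz.
    by apply: cz; exact: open_nbhs_nbhs.
  have [z [Fz Vz]] := Fpa _ nV.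
  exists (a + (z - p a)); split => //; left; rewrite /=.
  set t := (c - dotv a w) / dotv e w.
  have zE : a + (z - p a) + t *: e = z.
    by rewrite /p -/t; apply/rowP => i; rewrite !mxE; ring.
  by rewrite (pF _ t) zE; [exact: Fz.2|exact: Fz.1].
- by move=> ? [].
- move=> a t [_ /= Wa] [clFa nFa].
  have pa := pF a t (clF _ clFa); rewrite pa in Wa.
  by case: Wa => // Ua; apply: nFa; split => //; exact: clF.
Qed.

End faces.

(** * Admissible discretizations *)

Section admissible_discretization.
Context (R : realType) (d : nat) (Omega : set 'rV[R]_d) (D : discretization R d).
Hypothesis adm : admissible Omega D.
Implicit Types (K L M : cell D) (s : edge D).

Lemma edge_face s : exists w c U, [/\ w != 0, open U,
  edge_set s = flat w c `&` U & flat w c `&` U !=set0].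
Proof.
have [E [K [[w [c [w0 ->]]] _ s0 [U oU sE] _]]] := edge_flat adm s.
by exists w, c, U; split => //; rewrite -[flat w c `&` U]sE.
Qed.

Lemma cell_disj K L : K != L -> cell_set K `&` cell_set L = set0.
Proof.
move=> KL; apply/eqP/negPn/negP => /set0P KL0.
by have := cell_disjoint adm (i:=K) (j:=L) Logic.I Logic.I KL0; apply/eqP.
Qed.

Lemma boundary_open_closure (A : set 'rV[R]_d) : open A ->
  boundary A = closure A `\` A.
Proof. by move=> oA; rewrite /boundary (interior_id A).1. Qed.

Lemma edges_of_closure s K : s \in edges_of K ->
  edge_set s `<=` closure (cell_set K).
Proof.
move=> sK x sx; have : boundary (cell_set K) x.
  by rewrite (edges_ofP adm); exists s => //; exact: subset_closure.
by case.
Qed.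

Lemma interface_closure s K L : interface s K L ->
  edge_set s `<=` closure (cell_set K).
Proof. by move=> sKL x /subset_closure; rewrite sKL => -[]. Qed.

Lemma interface_sym s K L : interface s K L -> interface s L K.
Proof. by rewrite /interface setIC. Qed.

(** The closure of an edge lies in a hyperplane, and a cell does not. *)
Lemma interface_neq s K L : interface s K L -> K != L.
Proof.
move=> sKL; apply/eqP => KL; subst L.
have [w [c [U [w0 oU sE _]]]] := edge_face s.
have [k Kk] := off_flat c (cell_open adm (K:=K)) (cell_nonempty adm K) w0.
move=> /eqP; apply.
have : closure (edge_set s) k by rewrite sKL setIid; exact: subset_closure.
rewrite sE => /(@closure_subset _ _ (flat w c) (@subIsetl _ _ _)).
by rewrite -(closure_id _).1 //; exact: flat_closed.
Qed.

(** The edge s is contained in the boundary of K, which is covered by the closures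
    of finitely many edges of K; one of these closures has interior in the
    hyperplane of s, hence that edge meets s, and so it is s. *)
Lemma interface_edges_of s K L : interface s K L -> s \in edges_of K.
Proof.
move=> sKL; have KL := interface_neq sKL.
have [w [c [U [w0 oU sE s0]]]] := edge_face s.
have sub : flat w c `&` U `<=` \bigcup_(i in [set i | i \in enum (edges_of K)])
    closure (edge_set i).
  rewrite -sE => x sx; have : boundary (cell_set K) x.
    rewrite boundary_open_closure; last exact: (cell_open adm).
    split; first exact: interface_closure sKL _ sx.
    move=> Kx; have Lx := interface_closure (interface_sym sKL) sx.
    have [y [Ly Ky]] := Lx _ (open_nbhs_nbhs (conj (cell_open adm (K:=K)) Kx)).
    by have := cell_disj KL; rewrite -subset0 => /(_ y); apply.
  by rewrite (edges_ofP adm) => -[i iK ix]; exists i => //=; rewrite mem_enum.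
have [|i [V [iK oV VU V0 Vi]]] := closed_cover_flat _ oU s0 sub.
  by move=> i; exact: closed_closure.
have [w' [c' [U' [w'0 oU' iE i0]]]] := edge_face i.
rewrite iE in Vi; have := faces_meet w0 w'0 oV VU V0 Vi.
rewrite -sE -iE => /(edge_disjoint adm (i:=s) (j:=i) Logic.I Logic.I) ->.
by rewrite -mem_enum.
Qed.

Lemma interface_cells s K L M : interface s K L ->
  (s \in edges_of M) = (M == K) || (M == L).
Proof.
move=> sKL; apply/idP/orP => [sM|[]/eqP->]; last 2 first.
- exact: interface_edges_of sKL.
- exact: interface_edges_of (interface_sym sKL).
have [->|MK] := eqVneq M K; first by left.
right; apply: contraT => ML.
have [w [c [U [w0 oU sE s0]]]] := edge_face s.
have KL := cell_disj (interface_neq sKL).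
have := third_cell_meets w0 oU s0
  (cell_convex adm (K:=M)) (cell_open adm (K:=M)) (cell_nonempty adm M) _
  (cell_convex adm (K:=K)) (cell_open adm (K:=K)) (cell_nonempty adm K) _
  (cell_convex adm (K:=L)) (cell_open adm (K:=L)) (cell_nonempty adm L) _
  (cell_disj MK) (cell_disj ML).
rewrite KL -sE => -[||| x []] //; first exact: edges_of_closure.
  exact: interface_closure sKL.
exact: interface_closure (interface_sym sKL).
Qed.

Lemma interior_cells s : ~ exterior Omega s ->
  exists K L, interface s K L /\ K != L /\
    forall M, (s \in edges_of M) = (M == K) || (M == L).
Proof.
move=> ns; have [//|[K [L sKL]]] := edge_exterior_or_interface adm s.
exists K, L; split => //; split; first exact: interface_neq sKL.
by move=> M; exact: interface_cells.
Qed.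

Lemma generic_direction (e : 'rV[R]_d) K : exists2 a, cell_set K a &
  forall s t, ~ (closure (edge_set s) `\` edge_set s) (a + t *: e).
Proof.
suff [W [oW [a Wa] WK gen]] : exists W, [/\ open W, W !=set0, W `<=` cell_set K &
    forall s, s \in enum (edge D) -> forall a t, W a ->
      ~ (closure (edge_set s) `\` edge_set s) (a + t *: e)].
  exists a; first exact: WK.
  by move=> s t; apply: gen => //; rewrite mem_enum.
elim: (enum _) => [|s l [V [oV V0 VK gen]]].
  exists (cell_set K); split => //; first exact: (cell_open adm).
  exact: (cell_nonempty adm).
have [w [c [U [w0 oU sE _]]]] := edge_face s.
have [W [oW W0 WV genW]] := generic_line c e w0 oU oV V0; rewrite -sE in genW.
exists W; split => // [x /WV/VK//|i].
by rewrite inE => /orP[/eqP-> //|/gen h a t /WV]; exact: h.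
Qed.

Hypothesis Omega_bounded : bounded_set Omega.
Hypothesis d_gt0 : (0 < d)%N.

(** By contradiction, x being the last point on a generic line of the union A of
    the closures of the cells where u is nonzero: x is in the relative interior
    of an edge whose two cells are both part of A, so that A is a neighbourhood
    of x and the line does not leave A at x. *)
Lemma edge_connected_cells (u : cell D -> R) :
  (forall K s, s \in edges_of K -> exterior Omega s -> u K = 0) ->
  (forall K L s, ~ exterior Omega s -> s \in edges_of K -> s \in edges_of L ->
    u K = u L) ->
  forall K, u K = 0.
Proof.
move=> u_ext u_int K0; apply: contrapT => /eqP u0.
pose A := \bigcup_(K in [set K | u K != 0]) closure (cell_set K).
have clA : closed A.
  by apply: closed_bigcup => [|K _]; [exact: finite_finset|exact: closed_closure].
pose e : 'rV[R]_d := const_mx 1.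
have [a Ka gen] := generic_direction e K0.
pose T := [set t : R | A (a + t *: e)].
have T0 : T 0 by exists K0 => //; rewrite scale0r addr0; exact: subset_closure.
have [M AM] : exists M : R, forall x, A x -> `|x| <= M.
  move: Omega_bounded => /= [M [_ /(_ (M + 1))]]; rewrite ltrDl ltr01 => /(_ isT) OM.
  exists (M + 1) => y [K _ yK].
  have clB : closed [set y : 'rV[R]_d | `|y| <= M + 1].
    rewrite (_ : [set y | _] = (fun y : 'rV[R]_d => `|y|) @^-1` [set r | r <= M + 1]) //.
    apply: preimage_closed => [z _|].
      exact: norm_continuous.
    exact: closed_le.
  have : closure Omega y by rewrite (cell_cover adm); exists K.
  move=> /(closure_subset (B := [set y : 'rV[R]_d | `|y| <= M + 1])).
  by rewrite -(closure_id _).1 //; apply => z /OM.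
have ubT : has_sup T.
  split; first by exists 0.
  exists (M + `|a|) => t /AM tM.
  (* The first coordinate of a + t e is that of a plus t. *)
  have := mx_entry_le (a + t *: e) ord0 (Ordinal d_gt0).
  have := mx_entry_le a ord0 (Ordinal d_gt0).
  rewrite !mxE mulr1 => h1 h2.
  move: tM h1 (le_trans h2 tM) => _; rewrite !ler_norml.
  by move=> /andP[h1 h1'] /andP[h3 h3']; lra.
pose t := sup T; pose x := a + t *: e.
have Ax : A x.
  rewrite (closure_id A).1 // => B xB.
  have cx : a + r *: e @[r --> t] --> x.
    apply: cvgD; first exact: cst_continuous.
    by apply: cvgZ; [exact: cvg_id|exact: cst_continuous].
  have /nbhs_ballP[eps /= eps0 epsB] := cx _ xB.
  have [r Tr tr] := sup_adherent eps0 ubT.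
  exists (a + r *: e); split => //; apply: epsB.
  have rt : r <= t by apply: ub_le_sup => //; exact: ubT.2.
  by rewrite -ball_normE /= ger0_norm ?subr_ge0 // -/t in tr *; lra.
have notA : ~ nbhs x A.
  move=> /(near_ray e)[r /andP[r0 _]]; rewrite /x -addrA -scalerDl => Tr.
  have : t + r <= t by apply: ub_le_sup => //; exact: ubT.2.
  by rewrite gerDl leNgt r0.
have [K uK clK] := Ax.
have [Kx|nKx] := pselect (cell_set K x).
  apply: notA; apply: filterS (open_nbhs_nbhs (conj (cell_open adm (K:=K)) Kx)) => y Ky.
  by exists K => //; exact: subset_closure.
have : boundary (cell_set K) x.
  by rewrite boundary_open_closure //; exact: (cell_open adm).
rewrite (edges_ofP adm) => -[s /= sK sx].
have {}sx : edge_set s x by apply: contrapT => nsx; exact: (gen s t).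
have [es|ns] := pselect (exterior Omega s).
  by move: uK; rewrite /= (u_ext K s) ?eqxx.
have [P [Q [sPQ [PQ cells]]]] := interior_cells ns.
have sP : s \in edges_of P by rewrite cells eqxx.
have sQ : s \in edges_of Q by rewrite cells eqxx orbT.
apply: notA.
have [w [c [U [w0 oU sE _]]]] := edge_face s.
have EUx : (flat w c `&` U) x by rewrite -sE.
have EP : flat w c `&` U `<=` closure (cell_set P) by rewrite -sE; exact: edges_of_closure.
have EQ : flat w c `&` U `<=` closure (cell_set Q) by rewrite -sE; exact: edges_of_closure.
have := two_cells_nbhs w0 oU EUx (cell_convex adm (K:=P)) (cell_open adm (K:=P))
  (cell_nonempty adm P) EP (cell_convex adm (K:=Q)) (cell_open adm (K:=Q))
  (cell_nonempty adm Q) EQ (cell_disj PQ).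
apply: filterS => y [yP|yQ].
  by exists P => //=; rewrite -(u_int _ _ _ ns sK sP).
by exists Q => //=; rewrite -(u_int _ _ _ ns sK sQ).
Qed.

End admissible_discretization.

(** * Existence and uniqueness *)

Lemma cell_mean_coercive (R : realType) (d : nat) (Omega : set 'rV[R]_d)
    (Omega_open : open Omega) (Omega_bounded : bounded_set Omega)
    (Lambda : 'rV[R]_d -> 'M[R]_d)
    (Lambda_bounded : [bounded Lambda x | x in Omega])
    (Lambda_measurable : forall i j,
      measurable_fun (Omega : set (lebesgue_space R d)) (fun x => Lambda x i j))
    (alpha0 : R) (alpha0_gt0 : 0 < alpha0)
    (Lambda_coercive : {ae lebesgue R d, forall x, Omega x ->
      forall xi : 'rV[R]_d,
        alpha0 * dotv xi xi <= dotv (mxapp (Lambda x) xi) xi})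
    (A : set 'rV[R]_d) : open A -> A !=set0 -> A `<=` Omega ->
  0 < volume A /\ forall xi, xi != 0 ->
    0 < dotv (mxapp (volume A *: mean_matrix Lambda A) xi) xi.
Proof.
move=> oA A0 AO.
have bA : bounded_set A.
  by have [M [rM OM]] := Omega_bounded; exists M; split => // r Mr x /AO; exact: OM.
have vA := volume_gt0 oA A0 bA.
split=> // xi xi0; apply: lt_le_trans (mean_matrix_coercive (ltW alpha0_gt0) oA A0 bA _ _ _ xi).
- by rewrite mulr_gt0 ?mulr_gt0 ?dotv_gt0.
- by have [M [rM OM]] := Lambda_bounded; exists M; split => // r Mr x /AO; exact: OM.
- move=> i j; apply: measurable_funS (Lambda_measurable i j) => //.
  exact: open_lebesgue_measurable.
- have [N [mN N0 subN]] := Lambda_coercive; exists N; split => // x nx; apply: subN => Ox.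
  by apply: nx => /AO.
Qed.

Unset Implicit Arguments.

Theorem theorem2p1 (R : realType) (d : nat) (hd : (1 <= d)%N)
  (Omega : set 'rV[R]_d) (Omega_open : open Omega)
  (Omega_bounded : bounded_set Omega) (Omega_connected : connected Omega)
  (Omega_polygonal : polygonal Omega)
  (Lambda : 'rV[R]_d -> 'M[R]_d)
  (Lambda_bounded : [bounded Lambda x | x in Omega])
  (Lambda_measurable : forall i j,
     measurable_fun (Omega : set (lebesgue_space R d))
       (fun x => Lambda x i j))
  (alpha0 : R) (alpha0_gt0 : 0 < alpha0)
  (Lambda_coercive : {ae lebesgue R d, forall x, Omega x ->
     forall xi : 'rV[R]_d,
       alpha0 * dotv xi xi <= dotv (mxapp (Lambda x) xi) xi})
  (f : 'rV[R]_d -> R) (f_L2 : f \_ Omega \in Lfun (lebesgue R d) 2%:E)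
  (D : discretization R d) (D_admissible : admissible Omega D)
  (nu : cell D -> R) (nu_gt0 : forall K, 0 < nu K) :
  exists! w : {ffun cell D -> R} * {ffun cell D -> 'rV[R]_d}
              * {ffun cell D * edge D -> R},
    is_solution Omega Lambda f nu w.
Proof.
have cellP K := cell_mean_coercive Omega_open Omega_bounded Lambda_bounded
  Lambda_measurable alpha0_gt0 Lambda_coercive
  (cell_open D_admissible (K:=K)) (cell_nonempty D_admissible K)
  (cell_sub D_admissible (K:=K)).
pose ext (s : edge D) := `[< exterior Omega s >].
pose a (K : cell D) (s : edge D) : 'rV[R]_d :=
  barycenter (edge_set s) - Defs.center K.
pose B (K : cell D) : 'M[R]_d := volume (cell_set K) *: mean_matrix Lambda (cell_set K).
pose p (K : cell D) : R := nu K * volume (cell_set K).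
pose op := scheme_op (@edges_of R d D) ext a B p.
pose b : unknowns R d (cell D) (edge D) :=
  ([ffun K => \int[lebesgue R d]_(x in cell_set K) f x], 0, 0).
have two s : ~~ ext s -> exists K L, K != L /\
    forall M, (s \in edges_of M) = (M == K) || (M == L).
  move=> /asboolPn /(interior_cells D_admissible)[K [L [_ h]]].
  by exists K, L.
have B_gt0 K x : x != 0 -> 0 < dotv (mxapp (B K) x) x by exact: (cellP K).2.
have p_gt0 K : 0 < p K by rewrite mulr_gt0 // (cellP K).1.
have conn (u : cell D -> R) : (forall K s, s \in edges_of K -> ext s -> u K = 0) ->
    (forall K L s, ~~ ext s -> s \in edges_of K -> s \in edges_of L -> u K = u L) ->
    forall K, u K = 0.
  move=> h1 h2; apply: (edge_connected_cells D_admissible Omega_bounded hd).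
    by move=> K s sK /asboolP; exact: h1.
  by move=> K L s /asboolPn; exact: h2.
have [w [wb uniq]] := scheme_op_bij a two B_gt0 p_gt0 conn b.
suff equiv w' : is_solution Omega Lambda f nu w' <-> op w' = b.
  by exists w; split; [exact/equiv|move=> w' /equiv /uniq].
case: w' => [[u v] F].
have traceE K s : trace a p (u, v, F) K s =
  dotv (v K) (barycenter (edge_set s) - Defs.center K)
  + nu K * volume (cell_set K) * F (K, s) + u K by [].
have interiorE K L s : 
    (dotv (v K) (barycenter (edge_set s) - Defs.center K)
    + dotv (v L) (Defs.center L - barycenter (edge_set s))
    + nu K * volume (cell_set K) * F (K, s)
    - nu L * volume (cell_set L) * F (L, s) = u L - u K) <->
    trace a p (u, v, F) K s = trace a p (u, v, F) L s.
  by rewrite !traceE -(opprB _ (Defs.center L)) dotvNr; split => ?; lra.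
split.
- move=> [[Fout Fint Fext] Fcons vE divE]; congr (_, _, _).
  + by apply/ffunP => K; rewrite !ffunE; exact: divE.
  + apply/ffunP => K; rewrite !ffunE /=.
    apply/eqP; rewrite subr_eq0 -vE /B /mxapp; apply/eqP.
    by rewrite linearZ /= -scalemxAr.
  + apply/ffunP => -[K s]; rewrite [RHS]ffunE.
    have [sK|sK] := boolP (s \in edges_of K); last first.
      by rewrite ffunE /= sK; exact: Fout.
    have [es|es] := boolP (ext s).
      rewrite ffunE /= sK es /= traceE Fext //; last exact/asboolP.
      by rewrite addNr.
    have ns : ~ exterior Omega s by exact/asboolPn.
    have [P [Q [sPQ [PQ h]]]] := interior_cells D_admissible ns.
    have sP : s \in edges_of P by rewrite h eqxx.
    have sQ : s \in edges_of Q by rewrite h eqxx orbT.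
    have cPQ := Fcons _ _ _ ns sPQ.
    have tPQ : trace a p (u, v, F) P s = trace a p (u, v, F) Q s.
      by apply/interiorE; apply: Fint => //; exists s.
    move: sK; rewrite h => /orP[]/eqP->.
      by rewrite (interior_op a B p two _ es PQ sP sQ) /= cPQ tPQ add0r subrr.
    rewrite eq_sym in PQ; rewrite (interior_op a B p two _ es PQ sQ sP) /=.
    by rewrite [F (Q, s) + _]addrC cPQ tPQ add0r subrr.
- move=> opE.
  have op1 K : - \sum_(s in edges_of K) F (K, s) =
      \int[lebesgue R d]_(x in cell_set K) f x.
    by have := congr1 (fun w : unknowns _ _ _ _ => w.1.1 K) opE; rewrite !ffunE.
  have op2 K : mxapp (B K) (v K) = \sum_(s in edges_of K) F (K, s) *: a K s.
    have := congr1 (fun w : unknowns _ _ _ _ => w.1.2 K) opE.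
    by rewrite !ffunE => /eqP; rewrite subr_eq0 => /eqP.
  have op3 K s : (op (u, v, F)).2 (K, s) = 0 by rewrite opE /= ffunE.
  have ext0 K s : s \in edges_of K -> ext s -> trace a p (u, v, F) K s = 0.
    by move=> sK es; have := op3 K s; rewrite ffunE /= sK es.
  have int0 K L s : ~~ ext s -> interface s K L ->
      F (K, s) + F (L, s) = 0 /\ trace a p (u, v, F) K s = trace a p (u, v, F) L s.
    move=> es sKL; have sK := interface_edges_of D_admissible sKL.
    have sL := interface_edges_of D_admissible (interface_sym sKL).
    exact: (interior_eqs two es (interface_neq D_admissible sKL) sK sL
      (op3 K s) (op3 L s)).
  split.
  + split.
    * by move=> K s sK; have := op3 K s; rewrite ffunE /= sK.
    (* An exterior edge may be an interface; both traces then vanish. *)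
    * move=> K L _ s sKL; apply/interiorE.
      have [es|es] := boolP (ext s); last exact: (int0 K L s es sKL).2.
      have sK := interface_edges_of D_admissible sKL.
      have sL := interface_edges_of D_admissible (interface_sym sKL).
      by rewrite !ext0.
    * move=> K s sK /asboolP es; have := ext0 K s sK es.
      by rewrite traceE => /eqP; rewrite addr_eq0 => /eqP.
  + by move=> K L s /asboolPn es sKL; exact: (int0 K L s es sKL).1.
  + by move=> K; rewrite -op2 /B /mxapp linearZ /= -scalemxAr.
  + exact: op1.
Qed.
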